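(* Let $G$ be a connected graph with minimum degree $\delta(G)\geq 3$. If $D$ is a connected $2$-dominating set of $G$ with $|D|\ge 3$, then $rx_3(G)\leq rx_3(G[D])+4$, where $G[D]$ is the subgraph of $G$ induced by $D$. Moreover, the bound is tight: there exist a connected graph $G$ with $\delta(G)\ge 3$ and a connected $2$-dominating set $D$ of $G$ with $|D|\ge 3$ for which $rx_3(G)= rx_3(G[D])+4$.
   Context: All graphs are finite, simple, connected and undirected. Edge colorings are arbitrary (adjacent edges may receive the same color). In an edge-colored graph $G$, a tree $T\subseteq G$ (a subgraph that is a tree) is a rainbow tree if no two edges of $T$ have the same color. For a connected graph $G$ of order $n\ge 3$, a $3$-rainbow coloring of $G$ is an edge coloring such that for every set $S$ of $3$ vertices of $G$ there is a rainbow tree $T$ in $G$ with $S\subseteq V(T)$. The $3$-rainbow index $rx_3(G)$ is the minimum number of colors in a $3$-rainbow coloring of $G$. A set $D\subseteq V(G)$ is a $2$-dominating set if $|N_G(v)\cap D|\geq 2$ for every $v\in V(G)\setminus D$; it is a connected $2$-dominating set if moreover the induced subgraph $G[D]$ is connected. *)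

(* Defs.v *)
From mathcomp Require Import all_boot.
From mathcomp Require Import boolp.

Set Implicit Arguments.
Unset Strict Implicit.
Unset Printing Implicit Defensive.

Record sgraph := SGraph {
  vertex :> finType;
  adj : rel vertex;
  adj_sym : symmetric adj;
  adj_irrefl : irreflexive adj }.

Definition neighbours (G : sgraph) (v : G) : {set G} := [set u | adj v u].

Definition degree (G : sgraph) (v : G) : nat := #|neighbours v|.

(* Every degree is less than #|G|, so the initial value of the iterated minimum
   is irrelevant as soon as G has a vertex. *)
Definition min_degree (G : sgraph) : nat :=
  \big[minn/#|G|]_(v : G) degree v.

Lemma min_degreeP (G : sgraph) (k : nat) : 0 < #|G| ->
  reflect (forall v : G, k <= degree v) (k <= min_degree G).
Proof.
move=> G_gt0; apply: (iffP idP) => [kG v|kdeg].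
  apply: leq_trans kG _; rewrite /min_degree.
  have: v \in index_enum G by rewrite mem_index_enum.
  elim: (index_enum G) => // w s IHs; rewrite inE big_cons geq_min.
  by case/orP => [/eqP<-|/IHs->]; rewrite ?leqnn ?orbT.
apply: (big_ind (leq k)) => [|m n km kn|//]; last by rewrite leq_min km.
case/card_gt0P: G_gt0 => v0 _; exact: leq_trans (kdeg v0) (max_card _).
Qed.

Definition edges (G : sgraph) : {set {set G}} :=
  [set [set p.1; p.2] | p : G * G & adj p.1 p.2].

Definition connected_on (T : finType) (A : {set T}) (e : rel T) : Prop :=
  A != set0 /\ {in A &, forall x y, connect e x y}.

Definition acyclic (T : finType) (e : rel T) : Prop :=
  forall s : seq T, 2 < size s -> ~ ucycle e s.

Definition connected (G : sgraph) : Prop := connected_on [set: G] (@adj G).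

Section Induced.
Variables (G : sgraph) (D : {set G}).

Definition induced_adj : rel {x | x \in D} := fun x y => adj (val x) (val y).

Lemma induced_adj_sym : symmetric induced_adj.
Proof. by move=> x y; apply: adj_sym. Qed.

Lemma induced_adj_irrefl : irreflexive induced_adj.
Proof. by move=> x; apply: adj_irrefl. Qed.

Definition induced : sgraph := SGraph induced_adj_sym induced_adj_irrefl.

End Induced.

Definition two_dominating (G : sgraph) (D : {set G}) : Prop :=
  forall v : G, v \notin D -> 2 <= #|neighbours v :&: D|.

Definition connected_two_dominating (G : sgraph) (D : {set G}) : Prop :=
  two_dominating D /\ connected (induced D).

(* A subgraph is given by its vertex set U and its edge set F. *)
Definition is_subgraph (G : sgraph) (U : {set G}) (F : {set {set G}}) : Prop :=
  F \subset edges G /\ {in F, forall e : {set G}, e \subset U}.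

Definition edge_rel (T : finType) (F : {set {set T}}) : rel T :=
  fun x y => [set x; y] \in F.

Definition subtree (G : sgraph) (U : {set G}) (F : {set {set G}}) : Prop :=
  [/\ is_subgraph U F, connected_on U (edge_rel F) & acyclic (edge_rel F)].

(* An edge colouring is a function on all vertex sets, of which only the values
   on edges are ever used. *)
Definition rainbow3_coloring (G : sgraph) (C : Type) (c : {set G} -> C) : Prop :=
  forall S : {set G}, #|S| = 3 ->
    exists U F, [/\ subtree U F, {in F &, injective c} & S \subset U].

Definition rainbow3_colorable (G : sgraph) (k : nat) : Prop :=
  exists c : {set G} -> 'I_k, rainbow3_coloring c.

(* The value 0 for a graph without any 3-rainbow colouring is a placeholder:
   by rx3P below, it plays no role for connected graphs. *)
Definition rx3 (G : sgraph) : nat :=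
  if pselect (exists k, `[< rainbow3_colorable G k >]) is left ex_k
  then ex_minn ex_k else 0.

Lemma edge_rel_sym (T : finType) (F : {set {set T}}) : symmetric (edge_rel F).
Proof. by move=> x y; rewrite /edge_rel setUC. Qed.

Lemma edge_relE (G : sgraph) (x y : G) : edge_rel (edges G) x y = adj x y.
Proof.
apply/imsetP/idP => [[[a b]] /=|xy]; last first.
  by exists (x, y); rewrite ?inE.
rewrite inE /= => ab Exy.
have ab_neq : a != b by apply/eqP => Eab; rewrite Eab adj_irrefl in ab.
have: a \in [set x; y] by rewrite Exy set21.
have: b \in [set x; y] by rewrite Exy set22.
case/set2P => Eb /set2P[] Ea; move: ab ab_neq; rewrite Ea Eb ?eqxx //.
by rewrite adj_sym.
Qed.

Lemma spanning_tree (G : sgraph) :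
  connected G -> exists F, subtree [set: G] F.
Proof.
case=> G0 cG.
pose P (F : {set {set G}}) := (F \subset edges G) &&
  [forall x : G, forall y : G, connect (edge_rel F) x y].
have PE : P (edges G).
  rewrite /P subxx; apply/forallP => x; apply/forallP => y.
  rewrite (eq_connect (@edge_relE G)); exact: cG.
case: (arg_minnP (fun F : {set {set G}} => #|F|) PE) => F /andP[sF cF] minF.
exists F; split.
- by split=> // e _; apply: subsetT.
- by split=> // x y _ _; move/forallP: cF => /(_ x)/forallP/(_ y).
case=> [|x [|z q]] // sz /andP[]; set p := z :: q.
rewrite /cycle rcons_path => /andP[xp lx] Up.
set y := last x p in lx *.
pose F' := F :\ [set y; x].
suff /minF : P F'.
  by rewrite [#|F|](cardsD1 [set y; x]) -/F' (_ : _ \in F) // add1n ltnn.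
have step : path (edge_rel F') x p.
  apply/(pathP x) => i ilt; move/(pathP x)/(_ i ilt): (xp).
  rewrite /edge_rel /F' in_setD1 => ->; rewrite andbT.
  have nthE j k : j <= size p -> k <= size p ->
      (nth x (x :: p) j == nth x (x :: p) k) = (j == k).
    by move=> *; apply: nth_uniq.
  have yE : y = nth x (x :: p) (size p) by rewrite /y (last_nth x).
  apply/eqP => Ei.
  have: nth x (x :: p) i \in [set y; x] by rewrite -Ei set21.
  have: nth x (x :: p) i.+1 \in [set y; x] by rewrite -Ei set22.
  have xE z1 : (z1 == x) = (z1 == nth x (x :: p) 0) by [].
  rewrite !inE yE !xE.
  rewrite !nthE ?(ltnW ilt) // orbF => /eqP Ei1.
  by rewrite -Ei1 ltn_eqF //= => /eqP i0; move: sz; rewrite -[X in _ < X]/(size p).+1 -Ei1 i0.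
have cyx : connect (edge_rel F') x y by apply/connectP; exists p.
apply/andP; split; first exact: subset_trans (subsetDl _ _) sF.
apply/forallP => a; apply/forallP => b.
move/forallP: cF => /(_ a)/forallP/(_ b).
apply: connect_sub => {}a {}b ab.
have [E|ne] := eqVneq [set a; b] [set y; x]; last first.
  by apply: connect1; rewrite /edge_rel !inE ne.
have symF' := sym_connect_sym (edge_rel_sym F').
have : a \in [set y; x] by rewrite -E set21.
have : b \in [set y; x] by rewrite -E set22.
by rewrite !inE => /orP[]/eqP-> /orP[]/eqP->; rewrite ?connect0 // symF'.
Qed.

Lemma connected_rainbow3_colorable (G : sgraph) :
  connected G -> exists k, rainbow3_colorable G k.
Proof.
case/spanning_tree => F treeF.
exists #|{set G}|, (@enum_rank {set G}) => S _.
exists [set: G], F; split=> //.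
by move=> e f _ _; apply: enum_rank_inj.
Qed.

Lemma rx3P (G : sgraph) : connected G ->
  rainbow3_colorable G (rx3 G) /\
  (forall k, rainbow3_colorable G k -> rx3 G <= k).
Proof.
case/connected_rainbow3_colorable => k0 Gk0; rewrite /rx3.
case: pselect => [ex_k|[]]; last by exists k0; apply/asboolP.
by case: ex_minnP => k /asboolP Gk mink; split=> // m Gm; apply/mink/asboolP.
Qed.

(* Main.v *)
(* Upper bound.  Keep an optimal colouring of G[D] and use four new colours
   f0, f1, f2, f3.  Let X be a maximal independent set of G - D.  Every vertex
   outside D has one edge to D coloured f0 and another coloured f1 (if it is in
   X) or f2 (if it is not); further edges to D get the remaining one of f1 and
   f2, and all edges avoiding D get f3.  A vertex thus also reaches D by the
   remaining colour, either by a third edge to D or by an f3-edge to a neighbour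
   on the other side of X.  Of three vertices two are on the same side, and
   three disjoint connections to D can be chosen, which are completed by a
   rainbow tree of G[D].

   Tightness.  G[D] is a path with two edges, with a vertex outside D joined to
   an end and to the middle, and with many further vertices, each joined to
   these four vertices except the middle of the path.  With five colours, three
   of the latter have identically coloured edges, and any rainbow tree
   containing them has at least seven vertices. *)
Require Import Defs.
From mathcomp Require Import all_boot.

Set Implicit Arguments.
Unset Strict Implicit.
Unset Printing Implicit Defensive.

(** * Crossing edges, leaves and spanning subtrees *)

Lemma connect_crossing (T : finType) (e : rel T) (A : {set T}) (x y : T) :
  connect e x y -> x \in A -> y \notin A ->
  exists a b, [/\ a \in A, b \notin A & e a b].
Proof.
case/connectP => p; elim: p x => [|z p IHp] x /= => [_ -> ->//|].
case/andP => xz zp Ey xA yA; have [zA|zA] := boolP (z \in A).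
  exact: (IHp z).
by exists x, z.
Qed.

Lemma connected_on_single (T : finType) (x : T) (e : rel T) :
  connected_on [set x] e.
Proof.
split; first by apply/set0Pn; exists x; rewrite inE.
by move=> y z /set1P-> /set1P->; apply: connect0.
Qed.

Section Subgraphs.
Variable G : sgraph.
Implicit Types (U S : {set G}) (F : {set {set G}}) (u v : G).

Lemma adj_edge u v : adj u v -> [set u; v] \in edges G.
Proof. by move=> uv; apply/imsetP; exists (u, v); rewrite ?inE. Qed.

Lemma is_subgraph_leaf U F u v : is_subgraph U F -> u \in U -> adj u v ->
  is_subgraph (v |: U) ([set u; v] |: F).
Proof.
case=> FE FU uU uv; split.
  by rewrite subUset FE andbT sub1set adj_edge.
move=> e /setU1P[->|/FU eU]; last exact: subset_trans eU (subsetUr _ _).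
by rewrite subUset !sub1set !inE uU eqxx orbT.
Qed.

Lemma connected_on_leaf U F u v :
  connected_on U (edge_rel F) -> u \in U ->
  connected_on (v |: U) (edge_rel ([set u; v] |: F)).
Proof.
case=> _ cU uU; set e := edge_rel _.
have sub_e : subrel (connect (edge_rel F)) (connect e).
  by apply: connect_sub => x y xy; apply: connect1; apply/setU1P; right.
have e_sym : connect_sym e by apply/sym_connect_sym/edge_rel_sym.
have to_u x : x \in v |: U -> connect e u x.
  case/setU1P => [->|xU]; last by apply/sub_e/cU.
  by apply: connect1; rewrite /e /edge_rel setU11.
split; first by apply/set0Pn; exists v; rewrite setU11.
by move=> x y /to_u ux /to_u; apply: connect_trans; rewrite e_sym.
Qed.

(** The only neighbour of the new vertex [v] is [u]. A cycle through [v], rotated to start there,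
    would have [u] both as its second and as its last vertex, a repetition once it has length at
    least three. *)
Lemma acyclic_leaf U F u v :
  is_subgraph U F -> acyclic (edge_rel F) -> u \in U -> v \notin U ->
  acyclic (edge_rel ([set u; v] |: F)).
Proof.
case=> _ FU acF uU vU s sz /andP[cs Us]; set e := edge_rel _ in cs.
have neq_uv : u != v by apply: contraNneq vU => <-.
have nbr_v a : e v a -> a = u.
  rewrite /e /edge_rel; case/setU1P => [E|/FU].
    have: u \in [set v; a] by rewrite E set21.
    by rewrite !inE (negPf neq_uv) => /eqP.
  by rewrite subUset sub1set (negPf vU).
have [vs|vs] := boolP (v \in s); last first.
  apply: (acF s sz); rewrite /ucycle Us andbT.
  apply: (sub_in_cycle (P := [pred x | x != v])) cs => [x y|].
    rewrite !inE /= => xv yv; rewrite /e /edge_rel; case/setU1P => // E.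
    have: v \in [set x; y] by rewrite E set22.
    by rewrite !inE ![v == _]eq_sym (negPf xv) (negPf yv).
  by apply/allP => x xs; apply: contraNneq vs => <-.
case/rot_to: vs => i p Ep.
move: cs Us sz; rewrite -(rot_cycle i) -(rot_uniq i) -(size_rot i) {}Ep.
case: p => [|a [|b p]] //= /andP[/nbr_v-> /andP[_]].
rewrite rcons_path => /andP[_]; rewrite /e edge_rel_sym => /nbr_v Eu.
by case/and3P => _ /negP[]; rewrite -[X in X \in _]Eu mem_last.
Qed.

(* Adding crossing edges one by one to a single vertex only ever adds leaves. *)
Lemma connected_subtree U F :
  is_subgraph U F -> connected_on U (edge_rel F) ->
  exists F', [/\ F' \subset F, subtree U F' & #|F'|.+1 = #|U|].
Proof.
case=> FE FU [/set0Pn[x xU] cU].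
suff grow n : n < #|U| -> exists (A : {set G}) F',
    [/\ F' \subset F, A \subset U, subtree A F', #|F'| = n & #|A| = n.+1].
  have U_gt0 : 0 < #|U| by apply/card_gt0P; exists x.
  have [|A [F' [sF sA tA nF nA]]] := grow #|U|.-1; first by rewrite prednK.
  have EA : A = U by apply/eqP; rewrite eqEcard sA nA prednK ?leqnn.
  by exists F'; rewrite -EA; split=> //; rewrite nF nA.
elim: n => [_|n IHn ltnU].
  exists [set x], set0; split; rewrite ?sub0set ?sub1set ?cards0 ?cards1 //.
  split; [by split=> [|e]; rewrite ?sub0set ?inE | exact: connected_on_single |].
  by case=> [|a [|b s]] //= _ /andP[/=]; rewrite /edge_rel inE.
have [A [F' [sF sA [subA cA acA] nF nA]]] := IHn (ltnW ltnU).
have /subsetPn[y yU yA] : ~~ (U \subset A).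
  by apply: contraTN ltnU => /subset_leq_card; rewrite nA -leqNgt.
have /set0Pn[z zA] : A != set0 by rewrite -card_gt0 nA.
have [a [b [aA bA ab]]] := connect_crossing (cU _ _ (subsetP sA z zA) yU) zA yA.
have abF' : [set a; b] \notin F'.
  apply: contraNN bA => abF; have [_ /(_ _ abF)] := subA.
  by rewrite subUset !sub1set => /andP[].
have bU : b \in U by have := FU _ ab; rewrite subUset !sub1set => /andP[].
have abF : [set a; b] \in F := ab.
exists (b |: A), ([set a; b] |: F').
rewrite !subUset !sub1set sF sA bU abF !cardsU1 bA abF' nF nA; split=> //.
split.
- by apply: is_subgraph_leaf => //; rewrite -edge_relE; apply: (subsetP FE).
- exact: connected_on_leaf.
- exact: acyclic_leaf subA acA aA bA.
Qed.

End Subgraphs.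

(** * Rainbow connections to D by disjoint sets of new colours *)

Section Reach.
Variables (G : sgraph) (C : Type) (I : finType) (c : {set G} -> C + I).
Implicit Types (S D : {set G}) (A B : {set I}) (u v d : G).

(** In [C + I] the left summand holds the old colours and the right one the new; [A] bounds the new
    colours spent. Connectedness is asked for instead of a tree, so that pieces may overlap when
    they are glued; a tree is extracted only at the end. *)
Definition reach S A : Prop :=
  exists U F, [/\ is_subgraph U F, connected_on U (edge_rel F),
    {in F &, injective c}, S \subset U
    & forall e i, e \in F -> c e = inr i -> i \in A].

Lemma reach_sub S S' A : S' \subset S -> reach S A -> reach S' A.
Proof.
move=> sS' [U [F [UF cU injF SU FA]]]; exists U, F; split=> //.
exact: subset_trans SU.
Qed.

Lemma reach_leaf S A u v i : reach S A -> u \in S -> adj u v ->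
  c [set u; v] = inr i -> i \notin A -> reach (v |: S) (i |: A).
Proof.
move=> [U [F [UF cU injF SU FA]]] uS uv cuv iA.
have uU := subsetP SU u uS.
have new e : e \in F -> c e <> c [set u; v].
  by move=> eF Ec; case/negP: iA; apply: (FA e) => //; rewrite Ec.
exists (v |: U), ([set u; v] |: F); split.
- exact: is_subgraph_leaf.
- exact: connected_on_leaf.
- move=> e f /setU1P[->|eF] /setU1P[->|fF] //; last exact: injF.
    by move/esym/(new _ fF).
  by move/(new _ eF).
- exact: setUS.
- move=> e j /setU1P[->|eF]; first by rewrite cuv => -[<-]; rewrite setU11.
  by move/(FA _ _ eF) => jA; rewrite setU1r.
Qed.

(** Phrased as a way to enlarge any rainbow subgraph through the foot [d] whose new colours avoid
    [A], so that links with disjoint colour sets can be applied one after another. *)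
Definition link D A v : Prop :=
  exists2 d, d \in D & forall S B,
    reach S B -> d \in S -> A \subset ~: B -> reach (v |: S) (A :|: B).

Lemma link_in D A v : v \in D -> link D A v.
Proof.
move=> vD; exists v => // S B [U [F [UF cU injF SU FB]]] vS _.
exists U, F; split=> //; first by rewrite subUset sub1set (subsetP SU).
by move=> e i eF /(FB _ _ eF) iB; rewrite inE iB orbT.
Qed.

Lemma link_leg D v d i :
  d \in D -> adj v d -> c [set v; d] = inr i -> link D [set i] v.
Proof.
move=> dD vd ci; exists d => // S B rS dS; rewrite sub1set inE => iB.
by apply: (reach_leaf rS dS _ _ iB); [rewrite adj_sym | rewrite setUC].
Qed.

Lemma link_via D u v i A : link D A u -> adj u v -> c [set u; v] = inr i ->
  i \notin A -> link D (i |: A) v.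
Proof.
case=> d dD linkA uv ci iA; exists d => // S B rS dS.
rewrite subUset sub1set inE => /andP[iB AB].
apply: reach_sub (v |: (u |: S)) _ _ _ _; first by rewrite setUS ?subsetUr.
rewrite -setUA; apply: reach_leaf ci _ => //; first exact: linkA.
  exact: setU11.
by rewrite inE negb_or iA.
Qed.

(** The feet of the three links may coincide, hence the bound [#|T| <= 3] rather than an equality.
    Starting from a subgraph on the feet without new colours, the links are attached in turn. *)
Lemma reach_links D A1 A2 A3 x y z :
  (forall T : {set G}, T \subset D -> #|T| <= 3 -> reach T set0) ->
  link D A1 x -> link D A2 y -> link D A3 z ->
  A2 \subset ~: A1 -> A3 \subset ~: A1 -> A3 \subset ~: A2 ->
  exists A, reach [set x; y; z] A.
Proof.
move=> reachD [d1 d1D l1] [d2 d2D l2] [d3 d3D l3] A21 A31 A32.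
have r0 : reach [set d1; d2; d3] set0.
  apply: reachD; first by rewrite !subUset !sub1set d1D d2D.
  by rewrite setUC cardsU1 cards2; case: (_ \notin _) (_ != _) => [] [].
have r1 : reach (x |: [set d1; d2; d3]) (A1 :|: set0).
  by apply: l1 => //; rewrite ?setC0 ?subsetT ?inE ?eqxx.
have r2 : reach (y |: (x |: [set d1; d2; d3])) (A2 :|: (A1 :|: set0)).
  by apply: l2 => //; rewrite ?setU0 // !inE eqxx !orbT.
eexists; apply: reach_sub; last first.
  apply: (l3 _ _ r2); first by rewrite !inE eqxx !orbT.
  by rewrite setU0 setCU subsetI A32.
by rewrite !subUset !sub1set !inE !eqxx !orbT.
Qed.

End Reach.

(** * Extending a colouring of G[D] by four new colours *)

Lemma rainbow3_colorable_card (G : sgraph) (C : finType) (c : {set G} -> C) k :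
  #|C| = k -> rainbow3_coloring c -> rainbow3_colorable G k.
Proof.
move=> Ck rc; exists (fun e => cast_ord Ck (enum_rank (c e))) => S /rc.
case=> U [F [tF injF SU]]; exists U, F; split=> // e f eF fF.
by move/cast_ord_inj/enum_rank_inj; apply: injF.
Qed.

Lemma ex_superset (T : finType) (A B : {set T}) n :
  A \subset B -> #|A| <= n <= #|B| ->
  exists S : {set T}, [/\ A \subset S, S \subset B & #|S| = n].
Proof.
move=> sAB; elim: n => [|n IHn] /andP[An nB].
  by exists A; split=> //; apply/eqP; rewrite -leqn0.
move: An; rewrite leq_eqVlt => /orP[/eqP An|An]; first by exists A.
have [|S [AS SB nS]] := IHn; first by rewrite -ltnS An ltnW.
have /subsetPn[x xB xS] : ~~ (B \subset S).
  by apply: contraTN nB => /subset_leq_card; rewrite nS -leqNgt.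
exists (x |: S); rewrite subUset sub1set xB SB cardsU1 xS nS; split=> //.
exact: subset_trans (subsetUr _ _).
Qed.

Section Extension.
Variables (G : sgraph) (D : {set G}) (k : nat) (c0 : {set induced D} -> 'I_k).
Variable (b : G -> bool).
Implicit Types (u v d : G) (e : {set G}).

(* The four new colours are pairs of booleans: (false, false) is f0, (true, true)
   is f1, (true, false) is f2 and (false, true) is f3; b is the indicator of X. *)
Definition legs v : seq G := enum (neighbours v :&: D).

(** The first leg in the enumeration gets f0, the second the colour (f1 or f2) of the side of [v],
    and all later ones the colour of the other side. *)
Definition leg_color v d : bool * bool :=
  let i := index d (legs v) in
  if i == 0 then (false, false) else (true, b v (+) (i != 1)).

Definition ext_color e : 'I_k + bool * bool :=
  if [pick v in e :\: D] is Some v then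
    inr (if [pick d in e :&: D] is Some d then leg_color v d else (false, true))
  else inl (c0 [set x | val x \in e]).

Lemma ext_color_in (e : {set induced D}) : ext_color (val @: e) = inl (c0 e).
Proof.
rewrite /ext_color; case: pickP => [v|_].
  by case/setDP => /imsetP[x _ ->]; rewrite (valP x).
by congr (inl (c0 _)); apply/setP => x; rewrite inE mem_imset //; apply: val_inj.
Qed.

Lemma ext_color_leg v d : v \notin D -> d \in D ->
  ext_color [set v; d] = inr (leg_color v d).
Proof.
move=> vD dD; rewrite /ext_color; case: pickP => [w|/(_ v)]; last first.
  by rewrite !inE eqxx vD.
case/setDP => /set2P[->|->]; last by rewrite dD.
move=> _; case: pickP => [x|/(_ d)]; last by rewrite !inE eqxx orbT dD.
by case/setIP => /set2P[->|->] //; rewrite (negPf vD).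
Qed.

Lemma ext_color_out u v : u \notin D -> v \notin D ->
  ext_color [set u; v] = inr (false, true).
Proof.
move=> uD vD; rewrite /ext_color; case: pickP => [w _|/(_ v)]; last first.
  by rewrite !inE eqxx orbT vD.
case: pickP => // x /setIP[/set2P[]->]; first by rewrite (negPf uD).
by rewrite (negPf vD).
Qed.

(** [T] is padded to three vertices of D, and a rainbow tree of G[D] containing them is carried over
    to G along [val]. *)
Lemma reach_induced (T : {set G}) : rainbow3_coloring c0 -> 3 <= #|D| ->
  T \subset D -> #|T| <= 3 -> reach ext_color T set0.
Proof.
move=> rc D3 TD T3; have [|S [TS SD S3]] := ex_superset (n := 3) TD.
  by rewrite T3.
pose S0 : {set induced D} := [set x | val x \in S].
have ES : val @: S0 = S.
  apply/setP => x; apply/imsetP/idP => [[y]|xS]; first by rewrite inE => yS ->.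
  by exists (Sub x (subsetP SD x xS)); rewrite ?inE.
have S0_3 : #|S0| = 3 by rewrite -S3 -ES card_imset //; apply: val_inj.
have [U [F [[[FE FU] [U0 cU] _] injF SU]]] := rc S0 S0_3.
exists (val @: U), [set val @: (e : {set induced D}) | e in F]; split.
- split; last first.
    by move=> _ /imsetP[e eF ->]; apply/imsetS/FU.
  apply/subsetP => _ /imsetP[e eF ->].
  have /imsetP[[x y]] := subsetP FE e eF; rewrite inE /= => xy ->.
  by rewrite imsetU1 imset_set1; apply: adj_edge.
- split; first by case/set0Pn: U0 => x xU; apply/set0Pn; exists (val x); apply: imset_f.
  move=> _ _ /imsetP[x xU ->] /imsetP[y yU ->].
  case/connectP: (cU x y xU yU) => p xp ->; apply/connectP; exists (map val p).
    apply: homo_path xp => u v uv; apply/imsetP; exists [set u; v] => //.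
    by rewrite imsetU1 imset_set1.
  by rewrite last_map.
- move=> _ _ /imsetP[e eF ->] /imsetP[f fF ->]; rewrite !ext_color_in.
  by move=> [/(injF _ _ eF fF)->].
- by apply: subset_trans TS _; rewrite -ES; apply: imsetS.
- by move=> _ i /imsetP[e eF ->]; rewrite ext_color_in.
Qed.

Lemma link_nth v n : v \notin D -> n < #|neighbours v :&: D| ->
  link ext_color D
    [set if n == 0 then (false, false) else (true, b v (+) (n != 1))] v.
Proof.
rewrite cardE => vD ltn; set d := nth v (legs v) n.
have : d \in legs v by apply: mem_nth.
rewrite mem_enum !inE => /andP[vd dD]; apply: link_leg (vd) _ => //.
by rewrite ext_color_leg // /leg_color index_uniq // enum_uniq.
Qed.

Hypothesis D2 : two_dominating D.

Lemma link_base v : link ext_color D [set (false, false)] v.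
Proof.
have [vD|vD] := boolP (v \in D); first exact: link_in.
exact: (link_nth (n := 0)) (ltnW (D2 vD)).
Qed.

Lemma link_own v : link ext_color D [set (true, b v)] v.
Proof.
have [vD|vD] := boolP (v \in D); first exact: link_in.
by have := link_nth vD (D2 vD); rewrite /= addbF.
Qed.

Hypothesis D3 : forall v, v \notin D ->
  2 < #|neighbours v :&: D| \/ exists u, [/\ u \notin D, adj u v & b u != b v].

(** Either a third leg has the colour of the other side, or an f3-edge leads to a neighbour [u]
    across the bipartition, whose own leg has that colour. *)
Lemma link_other v :
  link ext_color D [set (true, ~~ b v)] v \/
  link ext_color D [set (false, true); (true, ~~ b v)] v.
Proof.
have [vD|vD] := boolP (v \in D); first by left; apply: link_in.
have [v3|[u [uD uv buv]]] := D3 vD; [left|right].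
  by have := link_nth vD v3; rewrite /= addbT.
apply: link_via uv _ _; last by rewrite inE.
  have -> : ~~ b v = b u by case: (b v) (b u) buv => [] [].
  exact: link_own.
exact: ext_color_out.
Qed.

Lemma reach_two_alike x y z : rainbow3_coloring c0 -> 3 <= #|D| ->
  b x = b y -> exists A, reach ext_color [set x; y; z] A.
Proof.
move=> rc cardD bxy.
have base T := @reach_induced T rc cardD.
(* If [z] is on the other side, [x] takes f0 while [y] and [z] take their own, distinct colours.
   Otherwise [z] takes the colour of the other side, possibly together with f3. *)
have [bz|bz] := eqVneq (b z) (b y); last first.
  apply: (reach_links base (link_base x) (link_own y) (link_own z));
    by rewrite sub1set !inE.
case: (link_other z) => lz; apply: (reach_links base (link_base x) (link_own y) lz);
  by rewrite ?subUset !sub1set !inE ?bz //; case: (b y).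
Qed.

Lemma ext_color_rainbow3 : rainbow3_coloring c0 -> 3 <= #|D| ->
  rainbow3_coloring ext_color.
Proof.
move=> rc cardD S S3.
suff [A [U [F [UF cU injF SU _]]]] : exists A, reach ext_color S A.
  have [F' [sF tF _]] := connected_subtree UF cU.
  exists U, F'; split=> // e f /(subsetP sF) eF /(subsetP sF); exact: injF.
have [x [y [z ->]]] : exists x y z, S = [set x; y; z].
  have : size (enum S) = 3 by rewrite -cardE.
  case E: (enum S) => [|x [|y [|z []]]] // _; exists x, y, z.
  by apply/setP => v; rewrite -mem_enum E !inE orbA.
have alike := reach_two_alike _ rc cardD.
have [xy|xy] := eqVneq (b x) (b y); first exact: alike.
have [xz|xz] := eqVneq (b x) (b z).
  have [A rA] := alike _ _ y xz; exists A; apply: reach_sub rA.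
  by rewrite !subUset !sub1set !inE !eqxx !orbT.
have yz : b y = b z by case: (b x) (b y) (b z) xy xz => [] [] [].
have [A rA] := alike _ _ x yz; exists A; apply: reach_sub rA.
by rewrite !subUset !sub1set !inE !eqxx !orbT.
Qed.

End Extension.

(* The vertices outside a maximal independent set X of G - D each have a
   neighbour in X, while a vertex of X has one outside X unless all of its
   neighbours, three at least, lie in D. *)
Lemma ex_bipartition (G : sgraph) (D : {set G}) : 3 <= min_degree G ->
  exists b : G -> bool, forall v, v \notin D ->
  2 < #|neighbours v :&: D| \/ exists u, [/\ u \notin D, adj u v & b u != b v].
Proof.
move=> deg3.
pose P (X : {set G}) := (X \subset ~: D) &&
  [forall u in X, forall v in X, ~~ adj u v].
have P0 : P set0 by rewrite /P sub0set; apply/forall_inP => u; rewrite inE.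
have [X /maxsetP[/andP[XD /forall_inP indX] maxX] _] := maxset_exists P0.
exists (fun v => v \in X) => v vD; have [vX|vX] := boolP (v \in X); last first.
  have [/exists_inP[u uX uv]|noX] := boolP [exists u in X, adj u v].
    by right; exists u; rewrite uX; split=> //; rewrite -in_setC (subsetP XD).
  case/negP: vX; rewrite -(maxX (v |: X)) ?setU11 ?subsetUr //.
  have nX u : u \in X -> ~~ adj u v.
    by move=> uX; apply: contraNN noX => uv; apply/exists_inP; exists u.
  rewrite /P subUset sub1set inE vD XD.
  apply/forall_inP => u /setU1P[->|uX]; apply/forall_inP => w /setU1P[->|wX].
  - by rewrite adj_irrefl.
  - by rewrite adj_sym nX.
  - exact: nX.
  - exact: (forall_inP (indX u uX)).
have [/existsP[u /andP[uD uv]]|noD] :=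
    boolP [exists u, (u \notin D) && adj u v].
  right; exists u; split=> //; rewrite eqb_id.
  by apply/negP => uX; case/negP: (forall_inP (indX u uX) v vX).
left; suff /setIidPl-> : neighbours v \subset D.
  by move/min_degreeP: deg3; apply; apply/card_gt0P; exists v.
apply/subsetP => u; rewrite inE => vu; apply: contraNT noD => uD.
by apply/existsP; exists u; rewrite uD adj_sym.
Qed.

Lemma rx3_two_dominating (G : sgraph) (D : {set G}) :
  connected G -> 3 <= min_degree G ->
  connected_two_dominating D -> 3 <= #|D| -> rx3 G <= rx3 (induced D) + 4.
Proof.
move=> cG deg3 [D2 cD] cardD.
have [[c0 rc0] _] := rx3P cD; have [b bP] := ex_bipartition D deg3.
apply: (rx3P cG).2; apply: rainbow3_colorable_card (ext_color_rainbow3 D2 bP rc0 cardD).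
by rewrite card_sum card_ord card_prod card_bool.
Qed.

(** * Tightness of the bound *)

Lemma pigeonhole (aT rT : finType) (f : aT -> rT) m :
  m * #|rT| < #|aT| -> exists y, m < #|[set x | f x == y]|.
Proof.
move=> lt_m; apply/existsP; apply: contraLR lt_m => /existsPn le_m.
rewrite -leqNgt -sum1_card (partition_big f xpredT) //= mulnC -sum_nat_const.
by apply: leq_sum => y _; rewrite sum1dep_card leqNgt le_m.
Qed.

(* The tight example: [inl hub], [inl near], [inl far], [inl apex] span the path
   near - hub - far plus a vertex apex joined to near and hub, and every
   [inr i] is joined to all of them but hub. *)
Definition hub : bool * bool := (true, true).
Definition near : bool * bool := (true, false).
Definition far : bool * bool := (false, true).
Definition apex : bool * bool := (false, false).

Section Example.
Variable T : finType.

Definition tight_adj (x y : (bool * bool) + T) : bool :=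
  match x, y with
  | inl p, inl q => (p != q) && [|| p == hub, q == hub | (p != far) && (q != far)]
  | inl p, inr _ | inr _, inl p => p != hub
  | inr _, inr _ => false
  end.

Lemma tight_adj_sym : symmetric tight_adj.
Proof. by case=> [[[] []]|i] [[[] []]|j]. Qed.

Lemma tight_adj_irrefl : irreflexive tight_adj.
Proof. by case=> [[[] []]|i]. Qed.

Definition tight_graph : sgraph := SGraph tight_adj_sym tight_adj_irrefl.

Notation base p := (inl p : tight_graph).
Notation pendant i := (inr i : tight_graph).

Definition tight_dom : {set tight_graph} :=
  [set base hub; base near; base far].

Lemma tight_graph_connected : connected tight_graph.
Proof.
split; first by apply/set0Pn; exists (base hub); rewrite inE.
have to_hub x : connect (@adj tight_graph) x (base hub).
  case: x => [[[] []]|i]; first exact: connect0; try exact: connect1.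
  by apply: (@connect_trans _ _ (base near)); apply: connect1.
move=> x y _ _; apply: connect_trans (to_hub x) _.
by rewrite (sym_connect_sym (@adj_sym tight_graph)).
Qed.

Lemma tight_graph_min_degree : 2 < #|T| -> 3 <= min_degree tight_graph.
Proof.
case/card_gt2P => i [j [l [_ [ij jl li]]]].
have pendants (x : tight_graph) :
    (forall t, adj x (pendant t)) -> 3 <= degree x.
  move=> adjx; apply/card_gt2P; exists (pendant i), (pendant j), (pendant l).
  by split; split; rewrite ?inE.
apply/min_degreeP; first by apply/card_gt0P; exists (base hub).
case=> [[[] []]|t]; do ?exact: pendants.
  by apply/card_gt2P; exists (base near), (base far), (base apex); split; split; rewrite ?inE.
by apply/card_gt2P; exists (base near), (base far), (base apex); split; split; rewrite ?inE.
Qed.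

Lemma adj_hub (x : tight_graph) :
  x \in tight_dom -> x != base hub -> adj (base hub) x.
Proof. by rewrite !inE => /orP[/orP[]|] /eqP->; rewrite ?eqxx. Qed.

Lemma adj_tight_dom (x y : tight_graph) : x \in tight_dom -> y \in tight_dom ->
  adj x y -> x = base hub \/ y = base hub.
Proof.
rewrite !inE => /orP[/orP[]|] /eqP-> /orP[/orP[]|] /eqP->; by [|left|right].
Qed.

Lemma base_in_dom p : (base p \in tight_dom) = (p != apex).
Proof. by case: p => [[] []]; rewrite !inE. Qed.

Lemma tight_dom_connected : connected (induced tight_dom).
Proof.
have hD : base hub \in tight_dom by rewrite base_in_dom.
pose h : induced tight_dom := exist _ (base hub) hD.
split; first by apply/set0Pn; exists h; rewrite inE.
have from_h (x : induced tight_dom) : connect (@adj _) h x.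
  have [->|xh] := eqVneq x h; first exact: connect0.
  by apply: connect1; apply: adj_hub; rewrite ?(valP x) // -[base hub]/(val h).
move=> x y _ _; apply: connect_trans (from_h y).
by rewrite (sym_connect_sym (@adj_sym (induced tight_dom))).
Qed.

Lemma tight_dom_two_dominating : two_dominating tight_dom.
Proof.
case=> [p|i]; first rewrite base_in_dom negbK => /eqP->.
  by apply/card_gt1P; exists (base hub), (base near); split; rewrite ?inE.
by move=> _; apply/card_gt1P; exists (base near), (base far); split; rewrite ?inE.
Qed.

Lemma card_tight_dom : #|tight_dom| = 3.
Proof. by rewrite /tight_dom setUC cardsU1 cards2 !inE. Qed.

Lemma rx3_tight_dom : rx3 (induced tight_dom) <= 2.
Proof.
apply: (rx3P tight_dom_connected).2.
have nD : base near \in tight_dom by rewrite base_in_dom.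
pose n : induced tight_dom := exist _ (base near) nD.
(* The induced path has just the edges hub-near and hub-far, told apart by whether they contain
   [near]; so its spanning tree is rainbow. *)
apply: (rainbow3_colorable_card (c := fun e => n \in e)) card_bool _ => S _.
have [] := @connected_subtree (induced tight_dom) setT (edges _).
- by split=> // e _; apply: subsetT.
- split=> [|x y _ _]; first exact: tight_dom_connected.1.
  by rewrite (eq_connect (@edge_relE _)); apply: tight_dom_connected.2.
move=> F [FE tF _]; exists setT, F; split; rewrite ?subsetT // => e f.
have hD : base hub \in tight_dom by rewrite base_in_dom.
have fD : base far \in tight_dom by rewrite base_in_dom.
pose h : induced tight_dom := exist _ (base hub) hD.
pose l : induced tight_dom := exist _ (base far) fD.
have edgeE g : g \in F -> g = if n \in g then [set h; n] else [set h; l].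
  move/(subsetP FE) => /imsetP[[x y]]; rewrite inE /= => xy.
  wlog Ex : x y xy / x = h.
    move=> IH; case: (adj_tight_dom (valP x) (valP y) xy) => E.
      by apply: IH => //; apply: val_inj.
    rewrite setUC; apply: IH; rewrite 1?tight_adj_sym //; exact: val_inj.
  move: xy; rewrite {x}Ex => hy ->.
  have : val y \in tight_dom := valP y.
  rewrite !inE => /orP[/orP[]|] /eqP Ey.
  - by rewrite Ey in hy.
  - by have -> : y = n; [apply: val_inj | rewrite eqxx orbT].
  - by have -> : y = l; [apply: val_inj | rewrite -!val_eqE].
by move=> /edgeE Ee /edgeE Ef nef; rewrite Ee Ef nef.
Qed.

(* Three pendants with the same colours meet any rainbow tree in one edge each,
   towards near, far and apex; as far is not adjacent to near or apex, such a
   tree has a seventh vertex. *)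
Lemma tight_graph_colorable k :
  2 * k ^ 3 < #|T| -> rainbow3_colorable tight_graph k -> 6 <= k.
Proof.
move=> ltT [c rc].
pose col i p := c [set pendant i; base p].
(* There are [k ^ 3] possible colour triples for a pendant, so three pendants share one. *)
have [|y /card_gt2P[i1 [i2 [i3 [[i1y i2y i3y] [i12 i23 i31]]]]]] :=
    @pigeonhole _ _ (fun i => (col i near, col i far, col i apex)) 2.
  by rewrite !card_prod !card_ord -[k * k * k]mulnA.
pose A : {set T} := [set i1; i2; i3].
have A3 : #|A| = 3.
  by rewrite /A setUC cardsU1 cards2 !inE i12 negb_or i31 eq_sym i23.
have colA i j p : i \in A -> j \in A -> p != hub -> col i p = col j p.
  have colY l : l \in A -> (col l near, col l far, col l apex) = y.
    move: i1y i2y i3y; rewrite !inE => /eqP y1 /eqP y2 /eqP y3.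
    by case/orP => [/orP[]|] /eqP->.
  move=> /colY Ei /colY; rewrite -Ei => -[En Ef Ea].
  by case: p => [[] []].
have inr_inj : injective (inr : T -> tight_graph) by move=> ? ? [].
have inl_inj : injective (inl : _ -> tight_graph) by move=> ? ? [].
have [|U [F [[UF cU _] injF SU]]] := rc [set pendant i | i in A].
  by rewrite card_imset.
have FE x z : edge_rel F x z -> adj x z.
  by move=> xz; rewrite -edge_relE; apply: (subsetP UF.1).
have pF i z : edge_rel F (pendant i) z -> exists2 p, p != hub & z = base p.
  by move/FE; case: z => [p|//]; exists p.
(* [r i p] says that the tree uses the edge from pendant [i] to [p]. Two pendants of [A] cannot use
   the same [p], as those edges have one colour. *)
pose r i p := (p != hub) && ([set pendant i; base p] \in F).
have r_inj i j p : i \in A -> j \in A -> r i p -> r j p -> i = j.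
  move=> iA jA /andP[ph ip] /andP[_ jp].
  have /setP/(_ (pendant i)) := injF _ _ ip jp (colA i j p iA jA ph).
  by rewrite !inE eqxx => /esym/orP[/eqP[]|/eqP].
have pU i : i \in A -> pendant i \in U.
  by move=> iA; apply/(subsetP SU)/imset_f.
have r_ex i : i \in A -> exists p, r i p.
  move=> iA; have /subsetPn[j jA ij] : ~~ (A \subset [set i]).
    by apply/negP => /subset_leq_card; rewrite A3 cards1.
  have [||x [z [/set1P-> _ xz]]] := @connect_crossing _ _ [set pendant i]
      (pendant i) (pendant j) (cU.2 _ _ (pU i iA) (pU j jA)).
  - by rewrite inE.
  - by apply: contraNN ij => /set1P[->]; rewrite inE.
  by have [p ph Ez] := pF _ _ xz; exists p; rewrite /r ph -Ez.
(* The default [hub] is never taken on [A], where every pendant has a tree edge. *)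
pose t i := odflt hub [pick p | r i p].
have rt i : i \in A -> r i (t i).
  by move/r_ex => [p ip]; rewrite /t; case: pickP => [//|/(_ p)]; rewrite ip.
have t_inj : {in A &, injective t}.
  by move=> i j iA jA tij; apply: (r_inj i j (t i)); rewrite ?rt // tij rt.
(* Three pendants are mapped injectively to the three base vertices other than [hub], hence
   bijectively. *)
have t_onto p : p != hub -> exists2 i, i \in A & p = t i.
  have tA : t @: A = [set~ hub].
    apply/eqP; rewrite eqEcard card_in_imset // A3 cardsC1 card_prod card_bool.
    rewrite andbT; apply/subsetP => _ /imsetP[i iA ->].
    by rewrite !inE; case/andP: (rt i iA).
  by move=> ph; apply/imsetP; rewrite tA !inE.
have r_t i p : i \in A -> r i p -> p = t i.
  move=> iA ip; have [j jA pj] := t_onto p (andP ip).1.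
  by rewrite (r_inj i j p) // pj rt.
have baseU p : p != hub -> base p \in U.
  case/t_onto => i iA ->; have /andP[_ /UF.2] := rt i iA.
  by rewrite subUset !sub1set => /andP[].
have [i0 i0A t0] := t_onto far isT.
pose W : {set tight_graph} :=
  [set pendant i | i in A] :|: [set base p | p in [set~ hub]].
have W6 : #|W| = 6.
  rewrite cardsU !card_imset // A3 cardsC1 card_prod card_bool.
  suff -> : [set pendant i | i in A] :&: [set base p | p in [set~ hub]] = set0.
    by rewrite cards0.
  apply/setP => x; rewrite !inE; apply/negP => /andP[/imsetP[i _ ->]].
  by case/imsetP.
have WU : W \subset U.
  rewrite subUset SU; apply/subsetP => _ /imsetP[p ph ->].
  by apply: baseU; rewrite !inE in ph.
(* With [i0] the pendant attached to far, some tree edge leaves the pair [far], [i0]. It does not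
   start at [i0], whose only tree edge goes to far; from far it leads neither to another pendant of
   [A] nor to near or apex, so its end lies outside [W]. *)
have [z zU zW] : exists2 z, z \in U & z \notin W.
  have [||x [z [xB zB xz]]] := @connect_crossing _ _ [set base far; pendant i0]
      (base far) (base near) (cU.2 _ _ (baseU far isT) (baseU near isT)).
  - exact: set21.
  - by rewrite !inE.
  exists z; first by move/UF.2: (xz); rewrite subUset !sub1set => /andP[].
  case/set2P: xB xz => -> xz.
    apply/negP => /setUP[] /imsetP[].
      move=> j jA Ez; case/negP: zB; rewrite Ez (r_inj j i0 far) ?set22 //.
        by rewrite /r /= setUC -Ez.
      by rewrite t0 rt.
    by move=> p ph Ez; move: (FE _ _ xz) ph; rewrite Ez !inE; case: p {Ez} => [[] []].
  have [p ph Ez] := pF _ _ xz; case/negP: zB.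
  by rewrite Ez (r_t i0 p) // -?t0 ?set21 // /r ph -Ez.
(* At least seven vertices force at least six edges, all of different colours. *)
have [F' [sF _ nF']] := connected_subtree UF cU.
have : #|F| <= k.
  by rewrite -(card_in_imset injF) (leq_trans (max_card _)) ?card_ord.
apply: leq_trans; apply: leq_trans (subset_leq_card sF).
rewrite -ltnS nF'; apply: (@leq_trans #|z |: W|).
  by rewrite cardsU1 zW W6.
by apply: subset_leq_card; rewrite subUset sub1set zU.
Qed.

End Example.

Theorem theorem2p1 :
  (forall (G : sgraph) (D : {set G}),
     connected G -> 3 <= min_degree G ->
     connected_two_dominating D -> 3 <= #|D| ->
     rx3 G <= rx3 (induced D) + 4)
  /\
  (exists (G : sgraph) (D : {set G}),
     [/\ connected G, 3 <= min_degree G,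
         connected_two_dominating D, 3 <= #|D|
       & rx3 G = rx3 (induced D) + 4]).
Proof.
split; first exact: rx3_two_dominating.
(* Here 251 is [2 * 5 ^ 3 + 1], enough for the pigeonhole argument with any number of colours up to
   five. *)
pose T : finType := 'I_251.
have cG := tight_graph_connected T.
have T2 : 2 < #|T| by rewrite card_ord.
have deg3 := tight_graph_min_degree T2.
have domD : connected_two_dominating (tight_dom T).
  by split; [apply: tight_dom_two_dominating | apply: tight_dom_connected].
have D3 : 3 <= #|tight_dom T| by rewrite card_tight_dom.
exists (tight_graph T), (tight_dom T); split=> //.
apply/eqP; rewrite eqn_leq rx3_two_dominating //=.
apply: (@leq_trans 6); first by rewrite (leq_add2r 4 _ 2) rx3_tight_dom.
have [/tight_graph_colorable col_ge _] := rx3P cG.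
rewrite leqNgt; apply/negP => lt6.
suff: 6 <= rx3 (tight_graph T) by rewrite leqNgt lt6.
by apply: col_ge; rewrite card_ord (@leq_ltn_trans (2 * 5 ^ 3)) // leq_mul2l leq_exp2r.
Qed.
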